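(* For every $\eta>0$ there is a constant $C=C(\eta)$ such that every $n$-vertex triangle-free graph $G$ with minimum degree $\delta(G)\geq n/3-n^{1-\eta}$ has chromatic number at most $C$. *)

(* Defs.v *)
From mathcomp Require Import all_boot.
From Stdlib Require Import Reals.

Set Implicit Arguments.
Unset Strict Implicit.
Unset Printing Implicit Defensive.

Definition simple_graph (T : finType) (e : rel T) : Prop :=
  symmetric e /\ irreflexive e.

Definition triangle_free (T : finType) (e : rel T) : Prop :=
  forall x y z : T, e x y -> e y z -> e z x -> False.

Definition deg (T : finType) (e : rel T) (x : T) : nat := #|[set y | e x y]|.

Definition proper_coloring (T : finType) (e : rel T) (k : nat) (c : T -> 'I_k) : Prop :=
  forall x y : T, e x y -> c x <> c y.

Definition chromatic_le (T : finType) (e : rel T) (k : nat) : Prop :=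
  exists c : T -> 'I_k, proper_coloring e c.

(* Main.v *)
(** Let [n] be the number of vertices and [s] the degree deficit. By weak
    (Frieze-Kannan) regularity the vertices fall into boundedly many classes such
    that [e(N u, N v)] is a small multiple of [n^2] for [u], [v] in one class,
    because [e(N u, N u) = 0]. Suppose a class contains an edge [u0 v0]. Then
    [N u0] and [N v0] cover about two thirds of the vertices, and almost all of
    these vertices form an independent set [G] of vertices joined to almost all of
    the remaining third. Put [Y = N(G)], let [Z] be its complement and let [beta]
    be the largest number of vertices of [Y] missed by a vertex of [G].
    A vertex of the class with more than [beta / 2] neighbours in [Y] sees a
    constant fraction of a fixed set [P] of size [O(beta)]; two such vertices with a
    common neighbour in [P] have almost the same neighbourhood, so they are not
    adjacent to each other, nor are two vertices sharing such neighbours with a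
    third one: a maximal family with disjoint traces on [P] gives 8 colours.
    For the other vertices of the class, [A u = N u :&: Z] satisfies
    [|Z| <= |A u| + |A v| + s], so along an edge the set [A] moves to its complement
    in [Z] up to an error [s]. Hence balls of radius less than about [n / s], a
    power of [n], are bipartite, and ball growing colours these vertices with a
    number of colours depending only on [eta]. *)

Require Import Defs.
From mathcomp Require Import all_boot all_order all_algebra.
From Stdlib Require Import Reals.
From mathcomp Require Import ssrnat zify ring lra.

Set Implicit Arguments.
Unset Strict Implicit.
Unset Printing Implicit Defensive.

Import Order.TTheory GRing.Theory Num.Theory.

(** * Weak regularity *)

Section CutRegularity.
Local Open Scope ring_scope.

Variable F : realFieldType.

Definition cut (T : finType) (a : T * T -> F) (A B : {set T}) : F :=
  \sum_(p in setX A B) a p.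

Definition energy (T : finType) (a : T * T -> F) : F := \sum_p a p ^+ 2.

Lemma cut_sub_rect (T : finType) (a : T * T -> F) (c : F) (S S' A B : {set T}) :
  cut (fun p => a p - c * (p \in setX S S')%:R) A B =
  cut a A B - c * (#|A :&: S|%:R * #|B :&: S'|%:R).
Proof.
rewrite /cut sumrB -mulr_sumr; congr (_ - _ * _).
rewrite -natr_sum -natrM; congr (_%:R).
rewrite -cardsX -sum1_card big_mkcond [RHS]big_mkcond /=.
apply: eq_bigr => -[x y] _; rewrite !inE /=.
by case: (x \in A); case: (x \in S); case: (y \in B); case: (y \in S').
Qed.

Lemma energy_sub_rect (T : finType) (a : T * T -> F) (c : F) (S S' : {set T}) :
  energy (fun p => a p - c * (p \in setX S S')%:R) =
  energy a - c * cut a S S' *+ 2 + c ^+ 2 * (#|S|%:R * #|S'|%:R).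
Proof.
rewrite -natrM -cardsX -sum1_card natr_sum mulr_sumr /energy /cut mulr_sumr.
rewrite -sumrMnl [X in _ - X]big_mkcond [X in _ + X]big_mkcond -sumrB -big_split.
apply: eq_bigr => p _ /=; case: (p \in _); last by rewrite /= mulr0 ?subr0 ?addr0.
by rewrite /= !mulr1 sqrrB [c * a p]mulrC.
Qed.

Lemma energy_ge0 (T : finType) (a : T * T -> F) : 0 <= energy a.
Proof. by apply: sumr_ge0 => p _; apply: sqr_ge0. Qed.

(** The coefficient is the average of [a] over the rectangle, so this is Pythagoras for the
    projection onto the indicator. *)
Lemma energy_sub_proj (T : finType) (a : T * T -> F) (S S' : {set T}) :
  (0 < #|S|)%nat -> (0 < #|S'|)%nat ->
  energy (fun p => a p - cut a S S' / (#|S|%:R * #|S'|%:R) *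
                           (p \in setX S S')%:R) =
  energy a - cut a S S' ^+ 2 / (#|S|%:R * #|S'|%:R).
Proof.
move=> S0 S'0; rewrite energy_sub_rect.
have h1 : (#|S|%:R : F) != 0 by rewrite pnatr_eq0 -lt0n.
have h2 : (#|S'|%:R : F) != 0 by rewrite pnatr_eq0 -lt0n.
have aux (E x s t : F) : s != 0 -> t != 0 ->
    E - x / (s * t) * x *+ 2 + (x / (s * t)) ^+ 2 * (s * t) = E - x ^+ 2 / (s * t).
  by move=> s0 t0; field; rewrite s0 t0.
exact: aux.
Qed.

Lemma cut_set0 (T : finType) (a : T * T -> F) (S S' : {set T}) :
  (#|S| == 0)%nat || (#|S'| == 0)%nat -> cut a S S' = 0.
Proof.
by move=> h; rewrite /cut big1 // => -[x y]; rewrite inE /=;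
  case/orP: h => /eqP/cards0_eq ->; rewrite inE ?andbF.
Qed.

(* Frieze-Kannan energy decrement: as long as some rectangle [S x S'] carries a
   cut larger than [eps n^2], subtracting its average lowers the energy by
   [eps^2 n^2], and recording [#|B :&: S'|] up to [n / m] controls the error. *)
Lemma cut_coloring (eps : F) (m k : nat) : 0 < eps -> (0 < m)%nat ->
  exists M : nat, forall (T : finType) (a : T * T -> F), (0 < #|T|)%nat ->
    energy a <= #|T|%:R ^+ 2 ->
    energy a <= k%:R * (eps * #|T|%:R) ^+ 2 ->
  exists f : {set T} -> 'I_M, forall A B, f A = f B ->
    `|cut a A B - cut a A A| <=
      (eps *+ 2 + k%:R / (eps * m%:R)) * #|T|%:R ^+ 2.
Proof.
move=> eps0 m0; elim: k => [|k [M IH]].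
  exists 1%nat => T a T0 _ ek; exists (fun _ => ord0) => A B _.
  have e0 : energy a = 0.
    by apply/eqP; rewrite eq_le energy_ge0 andbT (le_trans ek) // mul0r.
  have a0 p : a p = 0.
    apply/eqP; rewrite -sqrf_eq0; move/eqP: e0; rewrite psumr_eq0; last first.
      by move=> q _; apply: sqr_ge0.
    by move/allP/(_ p); rewrite mem_index_enum; apply.
  rewrite /cut !big1 // subrr normr0 mul0r addr0.
  by rewrite mulr_ge0 ?sqr_ge0 // mulrn_wge0 // ltW.
(* A colour encodes a pair: the colour for the corrected function and the rounded size of the trace
   on [S']. Only the second argument of [cut] varies, so this trace suffices. The outer successor
   makes room for the constant colour [ord0]. *)
exists ((M * m.+1).+1)%nat => T a T0 en ek.
set n : F := #|T|%:R in en ek *.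
have n0 : 0 < n by rewrite ltr0n.
have mr0 : 0 < m%:R :> F by rewrite ltr0n.
have em0 : 0 < eps * m%:R by rewrite mulr_gt0.
case: (boolP [exists S : {set T}, exists S' : {set T},
   eps * n ^+ 2 < `|cut a S S'|]) => [/existsP[S /existsP[S' big]]|]; last first.
  move/existsPn => small; exists (fun _ => ord0) => A B _.
  have sm X X' : `|cut a X X'| <= eps * n ^+ 2.
    by move: (small X) => /existsPn/(_ X'); rewrite -leNgt.
  apply: le_trans (ler_normB _ _) _.
  apply: le_trans (lerD (sm _ _) (sm _ _)) _.
  rewrite -mulr2n -mulrnAl ler_wpM2r ?sqr_ge0 // lerDl.
  by rewrite divr_ge0 ?ler0n // ltW.
have [S0 S'0] : (0 < #|S|)%nat /\ (0 < #|S'|)%nat.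
  apply/andP; rewrite !lt0n -negb_or; apply/negP => h; move: big.
  rewrite cut_set0 // normr0; apply/negP; rewrite -leNgt.
  by rewrite mulr_ge0 ?sqr_ge0 // ltW.
pose s : F := #|S|%:R; pose s' : F := #|S'|%:R.
pose c := cut a S S' / (s * s').
pose a' p := a p - c * (p \in setX S S')%:R.
have ea' : energy a' = energy a - cut a S S' ^+ 2 / (s * s').
  exact: energy_sub_proj.
have s0 : 0 < s by rewrite ltr0n.
have s'0 : 0 < s' by rewrite ltr0n.
have sn : s <= n by rewrite ler_nat max_card.
have s'n : s' <= n by rewrite ler_nat max_card.
(* Cauchy-Schwarz, read off from the nonnegative energy of [a']; it later bounds the coefficient
   [c]. *)
have cut2 : cut a S S' ^+ 2 <= s * s' * n ^+ 2.
  have := energy_ge0 a'; rewrite ea' subr_ge0 ler_pdivrMr ?mulr_gt0 // => h.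
  by apply: le_trans h _; rewrite mulrC ler_wpM2l // ltW // mulr_gt0.
have big2 : (eps * n ^+ 2) ^+ 2 < cut a S S' ^+ 2.
  by rewrite -[X in _ < X]real_normK ?num_real // ltrXn2r // mulr_ge0 ?sqr_ge0 // ltW.
have drop : (eps * n) ^+ 2 <= cut a S S' ^+ 2 / (s * s').
  rewrite ler_pdivlMr ?mulr_gt0 //; apply: le_trans (ltW big2).
  have -> : (eps * n ^+ 2) ^+ 2 = (eps * n) ^+ 2 * (n * n) by ring.
  by rewrite ler_wpM2l ?sqr_ge0 // ler_pM // ltW.
have en' : energy a' <= n ^+ 2.
  by rewrite ea'; apply: le_trans en; rewrite gerBl; apply: le_trans drop; apply: sqr_ge0.
have ek' : energy a' <= k%:R * (eps * n) ^+ 2.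
  rewrite ea'; move: ek; rewrite -natr1 mulrDl mul1r => ek.
  by rewrite lerBlDr; apply: le_trans ek _; rewrite lerD2l.
have [f' Hf'] := IH T a' T0 en' ek'.
have modm (X : {set T}) : ((#|X :&: S'| * m %/ #|T|) < m.+1)%nat.
  rewrite ltnS -{2}(mulKn m T0) leq_div2r // leq_mul2r max_card orbT //.
have lt_f (A : {set T}) : ((f' A * m.+1 + #|A :&: S'| * m %/ #|T|) < (M * m.+1).+1)%nat.
  have : ((f' A).+1 * m.+1 <= M * m.+1)%nat by rewrite leq_mul2r ltn_ord orbT.
  rewrite ltnS; apply: leq_trans.
  by rewrite mulSn addnC leq_add2r ltnW // modm.
exists (fun A => Ordinal (lt_f A)) => A B /(congr1 val) /= fAB.
have f'AB : f' A = f' B.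
  apply: val_inj; move: (congr1 (fun z => z %/ m.+1)%nat fAB).
  rewrite /= !divnMDl // [(_ %/ #|T| %/ _)%N]divn_small ?modm //.
  by rewrite [(_ %/ #|T| %/ _)%N]divn_small ?modm // !addn0.
have gAB : (#|A :&: S'| * m %/ #|T| = #|B :&: S'| * m %/ #|T|)%nat.
  by move: fAB; rewrite f'AB; apply: addnI.
have close : `|#|B :&: S'|%:R - #|A :&: S'|%:R : F| * m%:R <= n.
  have le_nat (x y t : nat) : (0 < t)%N -> (x %/ t = y %/ t)%N ->
      (x%:R : F) <= y%:R + t%:R.
    move=> t0 E; rewrite -natrD ler_nat {1}(divn_eq x t) E.
    by rewrite leq_add ?leq_divM // ltnW // ltn_pmod.
  rewrite -[X in _ * X]ger0_norm ?ler0n // -normrM mulrBl -!natrM ler_norml.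
  have h1 := le_nat _ _ _ T0 gAB; have h2 := le_nat _ _ _ T0 (esym gAB).
  by apply/andP; split; rewrite -/n in h1 h2; lra.
have split X Y : cut a X Y = cut a' X Y + c * (#|X :&: S|%:R * #|Y :&: S'|%:R).
  by rewrite cut_sub_rect subrK.
rewrite !split.
have -> : cut a' A B + c * (#|A :&: S|%:R * #|B :&: S'|%:R) -
  (cut a' A A + c * (#|A :&: S|%:R * #|A :&: S'|%:R)) =
  (cut a' A B - cut a' A A) +
    c * #|A :&: S|%:R * (#|B :&: S'|%:R - #|A :&: S'|%:R) by ring.
apply: le_trans (ler_normD _ _) _.
rewrite -natr1 [(_ + 1) / _]mulrDl mul1r addrA [X in _ <= X]mulrDl.
apply: lerD; first exact: Hf'.
rewrite normrM -(ler_pM2r mr0) -mulrA.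
have -> : (eps * m%:R)^-1 * n ^+ 2 * m%:R = n / eps * n.
  by field; rewrite ?(gt_eqF em0) ?(gt_eqF mr0) ?(gt_eqF eps0).
apply: ler_pM => //; first by rewrite mulr_ge0 // ler0n.
rewrite normrM /c normrM normfV [`|s * s'|]ger0_norm; last by rewrite mulr_ge0 // ltW.
rewrite [`|#|_|%:R|]ger0_norm ?ler0n //.
have cpos : 0 < `|cut a S S'|.
  by apply: le_lt_trans big; rewrite mulr_ge0 ?sqr_ge0 // ltW.
have AS : #|A :&: S|%:R <= s by rewrite ler_nat subset_leq_card // subsetIr.
apply: (@le_trans _ _ (`|cut a S S'| / s')).
  rewrite -mulrA ler_wpM2l ?normr_ge0 // mulrC ler_pdivrMr ?mulr_gt0 //.
  by rewrite mulrCA mulVf ?mulr1 // gt_eqF.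
rewrite ler_pdivrMr // mulrAC ler_pdivlMr //.
(* Multiplying by the cut creates its square, which [cut2] bounds; [big] then absorbs the factor
   [eps * n ^+ 2]. *)
rewrite -(ler_pM2r cpos).
have -> : `|cut a S S'| * eps * `|cut a S S'| = eps * cut a S S' ^+ 2.
  by rewrite -[in RHS]real_normK ?num_real //; ring.
apply: le_trans (ler_wpM2l (ltW eps0) cut2) _.
have -> : eps * (s * s' * n ^+ 2) = s * s' * (eps * n ^+ 2) by ring.
apply: ler_pM; [by rewrite mulr_ge0 // ltW | by rewrite mulr_ge0 ?sqr_ge0 // ltW | | exact: ltW].
by rewrite ler_wpM2r // ltW.
Qed.

End CutRegularity.

(** * Ball growing *)

(** Colours are natural numbers, so that a union gets disjoint palettes by a shift. *)
Definition colorable (T : finType) (e : rel T) (X : {set T}) (k : nat) : Prop :=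
  exists c : T -> nat, (forall x, x \in X -> c x < k) /\
    (forall x y, x \in X -> y \in X -> e x y -> c x <> c y).

Lemma colorable_setU (T : finType) (e : rel T) (X Y : {set T}) k l :
  colorable e X k -> colorable e Y l -> colorable e (X :|: Y) (k + l).
Proof.
move=> [c [cX cP]] [d [dY dP]].
exists (fun x => if x \in X then c x else k + d x); split=> [x|x y].
  rewrite inE; case: ifP => [xX _|_ /= xY]; first by rewrite ltn_addr ?cX.
  by rewrite ltn_add2l dY.
rewrite !inE; case: ifP => xX; case: ifP => yX /= xY yY exy.
- exact: cP.
- by have := cX x xX; lia.
- by have := cX y yX; lia.
- by have := dP x y xY yY exy; lia.
Qed.

Lemma colorableS (T : finType) (e : rel T) (X Y : {set T}) k l :
  X \subset Y -> k <= l -> colorable e Y k -> colorable e X l.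
Proof.
move=> /subsetP XY kl [c [cY cP]]; exists c; split=> [x xX|x y xX yX].
  exact: leq_trans (cY x (XY x xX)) kl.
by apply: cP; apply: XY.
Qed.

Lemma colorable_chromatic (T : finType) (e : rel T) k :
  colorable e setT k -> chromatic_le e k.
Proof.
move=> [c [ck cP]]; exists (fun x => Ordinal (ck x (in_setT x))) => x y exy.
by move/(congr1 val) => /=; apply: cP.
Qed.

Lemma colorable_classes (T : finType) (e : rel T) M (f : T -> 'I_M) k
    (X : {set T}) :
  (forall i, colorable e [set x in X | f x == i] k) ->
  colorable e X (M * k).
Proof.
move=> H; have [c Hc] := fin_all_exists H.
exists (fun x => f x * k + c (f x) x); split=> [x xX|x y xX yX exy].
  have [+ _] := Hc (f x) => /(_ x); rewrite !inE xX eqxx => /(_ isT).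
  have := ltn_ord (f x); nia.
have [cx cP] := Hc (f x); have [cy _] := Hc (f y).
have {}cx : c (f x) x < k by apply: cx; rewrite !inE xX eqxx.
have {}cy : c (f y) y < k by apply: cy; rewrite !inE yX eqxx.
have [fxy|ne] := eqVneq (f x) (f y).
  move: (cP x y); rewrite !inE xX yX fxy eqxx exy /= => /(_ isT isT isT); lia.
by move=> E; case/negP: ne; apply/eqP/val_inj => /=; nia.
Qed.

Section BallGrowing.

Variables (T : finType) (e : rel T).

Fixpoint ball (S : {set T}) (v : T) (r : nat) : {set T} :=
  if r is r'.+1 then
    ball S v r' :|: [set y in S | [exists x in ball S v r', e x y]]
  else [set v].

Lemma ball_mono (S S' : {set T}) v r : S \subset S' -> ball S v r \subset ball S' v r.
Proof.
move=> /subsetP SS'; elim: r => //= r /subsetP IH; apply/subsetP => y.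
rewrite !inE => /orP[/IH ->//|/andP[/SS' ->]] /existsP[x /andP[/IH xb exy]].
by apply/orP; right; apply/existsP; exists x; rewrite xb.
Qed.

Lemma ball_sub (S : {set T}) v r : v \in S -> ball S v r \subset S.
Proof.
move=> vS; elim: r => [|r IH] /=; first by rewrite sub1set.
by rewrite subUset IH; apply/subsetP => y; rewrite inE => /andP[].
Qed.

Lemma ball_center (S : {set T}) v r : v \in ball S v r.
Proof. by elim: r => [|r IH] /=; rewrite !inE ?eqxx ?IH. Qed.

Lemma ball_le (S : {set T}) v r r' :
  r <= r' -> ball S v r \subset ball S v r'.
Proof.
move/subnK <-; elim: (r' - r) => //= d IH.
by apply: subset_trans IH _; apply: subsetUl.
Qed.

(** Otherwise each of [R] steps multiplies the ball by more than [1 + 1/q], and the ball outgrows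
    [S]. *)
Lemma slow_growth (S : {set T}) v q R : 0 < q -> v \in S ->
  #|S| * q ^ R < q.+1 ^ R ->
  exists2 r, r < R & q * #|ball S v r.+1 :\: ball S v r| <= #|ball S v r|.
Proof.
move=> q0 vS lt.
have [/existsP[r hr]|/existsPn H] :=
  boolP [exists r : 'I_R, q * #|ball S v r.+1 :\: ball S v r| <= #|ball S v r|].
  by exists r.
have grow r : r <= R -> q.+1 ^ r <= #|ball S v r| * q ^ r.
  elim: r => [|r IH] rR; first by rewrite /= cards1.
  have h : #|ball S v r| < q * #|ball S v r.+1 :\: ball S v r|.
    by rewrite ltnNge; apply: (H (Ordinal rR)).
  have := IH (ltnW rR); have := cardsD (ball S v r.+1) (ball S v r).
  rewrite (setIidPr (ball_le S v (leqnSn r))).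
  have := subset_leq_card (ball_le S v (leqnSn r)).
  rewrite !expnS.
  set a := q.+1 ^ r; set b := q ^ r; set x := #|ball S v r|.
  set y := #|ball S v r.+1| => xy dE ab.
  rewrite dE in h.
  have : q.+1 * x <= y * q by nia.
  nia.
have := grow R (leqnn R); have := subset_leq_card (ball_sub R vS); nia.
Qed.

Hypothesis sym_e : symmetric e.

(** Carve off a ball with a thin boundary layer, put the layer into [L], and recurse on the rest.
    Each layer is charged to its own ball, and these balls are disjoint. *)
Lemma ball_growing_pass (X : {set T}) q R (P : T -> T -> bool) : 0 < q ->
  #|X| * q ^ R < q.+1 ^ R ->
  (forall v x y, v \in X -> x \in ball X v R -> y \in ball X v R ->
     e x y -> P v x != P v y) ->
  forall S : {set T}, S \subset X ->
  exists2 L : {set T}, L \subset S & q * #|L| <= #|S| /\ colorable e (S :\: L) 2.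
Proof.
move=> q0 lt HP S; have [m] := ubnP #|S|; elim: m S => // m IH S Sm SX.
have [->|[v vS]] := set_0Vmem S.
  exists set0; first exact: sub0set.
  by rewrite cards0 muln0; split=> //; exists (fun _ => 0);
    split=> [x|x y]; rewrite !inE.
have ltS : #|S| * q ^ R < q.+1 ^ R.
  by apply: leq_ltn_trans lt; rewrite leq_mul2r subset_leq_card ?orbT.
have [r rR hr] := slow_growth q0 vS ltS.
set B := ball S v r in hr; set B' := ball S v r.+1 in hr.
have BB' : B \subset B' by apply: ball_le.
have B'S : B' \subset S by apply: ball_sub.
have vB : v \in B by apply: ball_center.
have [||L LS [qL [c [c2 cP]]]] := IH (S :\: B').
- have := cardsD S B'; rewrite (setIidPr B'S).
  have : 0 < #|B'| by apply/card_gt0P; exists v; apply: (subsetP BB').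
  have := subset_leq_card B'S; lia.
- by apply: subset_trans (subsetDl _ _) SX.
have LSS : L \subset S by apply: subset_trans LS (subsetDl _ _).
exists (L :|: (B' :\: B)).
  by rewrite subUset LSS; apply: subset_trans (subsetDl _ _) B'S.
split.
  have h1 := cardsD S B'; rewrite (setIidPr B'S) in h1.
  have h2 := subset_leq_card B'S; have h3 := subset_leq_card BB'.
  have h4 : #|L :|: (B' :\: B)| <= #|L| + #|B' :\: B| by rewrite cardsU leq_subr.
  nia.
have BX : B \subset ball X v R.
  by apply: subset_trans (ball_mono v r SX) (ball_le _ _ (ltnW rR)).
have vX : v \in X by apply: (subsetP SX).
have BC x y : x \in S -> x \in B -> y \in S -> e x y -> y \in B'.
  move=> xS xB yS exy; rewrite /B' /= !inE yS /=; apply/orP; right.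
  by apply/existsP; exists x; rewrite xB.
have nL z : z \in S -> z \notin B -> z \notin L :|: (B' :\: B) ->
    z \in S :\: B' :\: L.
  by move=> zS zB; rewrite !inE zS zB /= negb_or => /andP[-> ->].
(* Neighbours in [S] of the ball lie in [B']; with the layer gone, the ball and the rest can share
   the same two colours. *)
exists (fun x => if x \in B then P v x : nat else c x); split=> [x|x y].
  rewrite inE => /andP[xL xS]; case: ifP => [_|/negbT xB]; first by case: (P v x).
  exact: c2 (nL x xS xB xL).
rewrite ![_ \in S :\: _]inE => /andP[xL xS] /andP[yL yS] exy.
case: ifP => [xB|/negbT xB]; case: ifP => [yB|/negbT yB].
- by have := HP v x y vX (subsetP BX _ xB) (subsetP BX _ yB) exy;
    case: (P v x); case: (P v y).
- by move: yL; rewrite in_setU in_setD yB (BC x y) // orbT.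
- by move: xL; rewrite in_setU in_setD xB (BC y x) ?orbT // sym_e.
- by apply: cP => //; apply: nL.
Qed.

(* The argument of Kierstead, Szemeredi and Trotter for graphs of large odd girth. *)
Lemma ball_growing (X : {set T}) q R K (P : T -> T -> bool) : 0 < q ->
  #|X| * q ^ R < q.+1 ^ R -> #|X| < q ^ K ->
  (forall v x y, v \in X -> x \in ball X v R -> y \in ball X v R ->
     e x y -> P v x != P v y) ->
  colorable e X (K * 2).
Proof.
move=> q0 ltR ltK HP.
(* Each pass spends two colours and shrinks the uncoloured part by a factor [q]; [j] counts the
   passes left. *)
suff H j (S : {set T}) : S \subset X -> #|S| < q ^ j -> colorable e S (j * 2).
  exact: H.
elim: j S => [|j IH] S SX Sj.
  exists (fun _ => 0).
  have -> : S = set0 by apply/eqP; rewrite -cards_eq0; move: Sj; rewrite expn0; lia.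
  by split=> [x|x y]; rewrite inE.
have [L LS [qL col]] := ball_growing_pass q0 ltR HP SX.
have {}IH : colorable e L (j * 2).
  apply: IH; first exact: subset_trans LS SX.
  by rewrite -(ltn_pmul2l q0) -expnS; apply: leq_ltn_trans qL Sj.
apply: (colorableS (Y := (S :\: L) :|: L)) (colorable_setU col IH).
  by rewrite setUC -{1}(setID S L) (setIidPr LS).
by rewrite mulSn.
Qed.

End BallGrowing.

(** * Classes of vertices with similar neighbourhoods *)

Section Edges.

Variables (T : finType) (e : rel T).

Definition nbhd (x : T) : {set T} := [set y | e x y].

Definition edges (A B : {set T}) : nat := \sum_(x in A) #|nbhd x :&: B|.

End Edges.

Section EdgesColoring.
Local Open Scope ring_scope.

Lemma edges_coloring (m : nat) : (0 < m)%N ->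
  exists M : nat, forall (T : finType) (e : rel T), (0 < #|T|)%N ->
  exists f : {set T} -> 'I_M, forall A B, f A = f B ->
    (m * edges e A B <= m * edges e A A + #|T| ^ 2)%N.
Proof.
(* With [eps = 1/q], the term [eps *+ 2] is [1/(2m)] and the rounding term is another [1/(2m)]. The
   energy is at most [n^2 = q^2 (eps n)^2], hence [q ^ 2] decrements. *)
move=> m0; pose q := (4 * m)%N.
have q0 : (0 < q)%N by rewrite muln_gt0.
pose eps : rat := q%:R^-1.
have qr0 : 0 < q%:R :> rat by rewrite ltr0n.
have eps0 : 0 < eps by rewrite invr_gt0.
have r0 : (0 < 2 * m * q ^ 3)%N by rewrite muln_gt0 expn_gt0 q0 muln_gt0 m0.
have [M HM] := cut_coloring (q ^ 2) eps0 r0.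
exists M => T e T0; pose a (p : T * T) : rat := (e p.1 p.2)%:R.
have en : energy a <= #|T|%:R ^+ 2.
  rewrite expr2 -natrM -card_prod -sum1_card natr_sum; apply: ler_sum => p _.
  by rewrite /a; case: (e _ _).
have [||f Hf] := HM T a T0 => //.
  apply: le_trans en _; rewrite exprMn mulrA natrX /eps exprVn mulfV ?mul1r //.
  by rewrite expf_neq0 // gt_eqF.
exists f => A B fAB; have := Hf A B fAB.
have cutE X Y : cut a X Y = (edges e X Y)%:R.
  rewrite /edges natr_sum /cut.
  transitivity (\sum_(x in X) \sum_(y in Y) a (x, y)).
    by rewrite pair_big_dep; apply: eq_big => [[x y]|[x y]] //; rewrite inE.
  apply: eq_bigr => x _; rewrite -sum1_card natr_sum big_mkcond [RHS]big_mkcond /=.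
  apply: eq_bigr => y _; rewrite !inE /a /=.
  by case: (y \in Y); case: (e x y).
rewrite !cutE ler_norml => /andP[_].
have -> : eps *+ 2 + (q ^ 2)%:R / (eps * (2 * m * q ^ 3)%:R) = m%:R^-1 :> rat.
  have mr0 : m%:R != 0 :> rat by rewrite pnatr_eq0 -lt0n.
  by rewrite /eps natrM [(q ^ _)%:R]natrX [(q ^ _)%:R]natrX /q !natrM; field; rewrite mr0.
move=> h; rewrite -(ler_nat rat) natrD [(_ ^ 2)%:R]natrX !natrM.
have mr0 : 0 < m%:R :> rat by rewrite ltr0n.
rewrite -lerBlDl -mulrBr; move: h; rewrite -(ler_pM2l mr0) mulrA mulfV ?mul1r //.
by rewrite gt_eqF.
Qed.

End EdgesColoring.

Section Structure.

Variables (T : finType) (e : rel T).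
Hypotheses (sym_e : symmetric e) (tri : triangle_free e).

Local Notation n := #|T|.
Local Notation N := (nbhd e).

Variable s : nat.
Hypotheses (n_gt0 : 0 < n) (s_small : 100 * s <= n).
Hypothesis min_deg : forall x, n <= 3 * #|N x| + s.

Lemma nbhd_adj x y : e x y -> N x :&: N y = set0.
Proof.
move=> exy; apply/setP => z; rewrite !inE; apply/negP => /andP[exz eyz].
by apply: (tri exy eyz); rewrite sym_e.
Qed.

Lemma cardsU_adj x y : e x y -> #|N x :|: N y| = #|N x| + #|N y|.
Proof. by move=> exy; rewrite cardsU nbhd_adj // cards0 subn0. Qed.

Lemma edges_self x : edges e (N x) (N x) = 0.
Proof.
apply: big1 => y; rewrite inE => exy.
by rewrite setIC nbhd_adj // cards0.
Qed.

(** * Structure around an edge inside a class *)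

Section Class.

Variables (X : {set T}) (u0 v0 : T).
Hypotheses (u0X : u0 \in X) (v0X : v0 \in X) (e00 : e u0 v0).
Hypothesis near : forall u v, u \in X -> v \in X ->
  200 * 100 * edges e (N u) (N v) <= n * n.

Let U0 := N u0 :|: N v0.
Let W := ~: U0.
Let G := [set z | 100 * #|N z :&: U0| <= n].

Lemma card_remainder : 3 * #|W| <= n + 2 * s.
Proof.
have := cardsC U0; rewrite /U0 cardsU_adj // -/U0 -/W.
have := min_deg u0; have := min_deg v0; lia.
Qed.

Lemma good_nbhd z : z \in G -> 100 * n <= 300 * #|W :&: N z| + 100 * s + 3 * n.
Proof.
rewrite inE => h; have := min_deg z; have := cardsID U0 (N z).
by rewrite setDE -/W [N z :&: W]setIC; lia.
Qed.

Lemma good_miss z : z \in G -> 100 * #|W :\: N z| <= 100 * s + n.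
Proof.
move=> zG; have := good_nbhd zG; have := cardsID (N z) W; have := card_remainder.
lia.
Qed.

(** Adjacent vertices have disjoint neighbourhoods, but each of these two would fill almost all of
    [W]. *)
Lemma good_indep z z' : z \in G -> z' \in G -> ~~ e z z'.
Proof.
move=> zG z'G; apply/negP => ezz'.
have h1 := good_nbhd zG; have h2 := good_nbhd z'G; have h3 := card_remainder.
have : (W :&: N z) :|: (W :&: N z') \subset W by rewrite subUset !subsetIl.
move/subset_leq_card; rewrite cardsU -setIIr nbhd_adj // setI0 cards0 subn0; lia.
Qed.

(** Each vertex of [N v] outside [G] sends more than [n / 100] edges to [U0], while [near] for [u0]
    and [v0] allows at most [n^2 / 10000] in total. *)
Lemma nbhd_bad v : v \in X -> 100 * #|N v :\: G| <= n.
Proof.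
move=> vX.
have h1 : #|N v :\: G| * n <= 100 * \sum_(x in N v) #|N x :&: U0|.
  rewrite -sum_nat_const big_distrr /=.
  rewrite [X in _ <= X](bigID (fun x => x \in G)) /=; apply: leq_trans (leq_addl _ _).
  rewrite big_mkcond [X in _ <= X]big_mkcond /=; apply: leq_sum => x _.
  rewrite inE andbC; case: ifP => // /andP[_]; rewrite inE -ltnNge; exact: ltnW.
have h2 : \sum_(x in N v) #|N x :&: U0| <= edges e (N v) (N u0) + edges e (N v) (N v0).
  rewrite /edges -big_split /=; apply: leq_sum => x _.
  by rewrite setIUr cardsU leq_subr.
have h3 := near vX u0X; have h4 := near vX v0X.
rewrite -(leq_pmul2r n_gt0); lia.
Qed.

(** The set [G :&: W] is small: any vertex in it misses all of it by independence, yet misses little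
    of [W]. *)
Lemma nbhd_remainder v : v \in X -> 100 * #|N v :&: W| <= 2 * n + 100 * s.
Proof.
move=> vX; have h1 := nbhd_bad vX.
have h2 : 100 * #|G :&: W| <= 100 * s + n.
  have [->|[z]] := set_0Vmem (G :&: W); first by rewrite cards0.
  rewrite inE => /andP[zG _]; apply: leq_trans (good_miss zG).
  rewrite leq_mul2l /=; apply: subset_leq_card; apply/subsetP => y.
  rewrite !inE => /andP[yG ->]; rewrite andbT.
  by apply: good_indep; rewrite // inE.
have : N v :&: W \subset (N v :\: G) :|: (G :&: W).
  by apply/subsetP => y; rewrite !(in_setI, in_setU, in_setD) => /andP[-> ->];
    rewrite !andbT orNb.
move/subset_leq_card; rewrite cardsU; lia.
Qed.

Lemma good_class_meet z v : z \in G -> v \in X ->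
  100 * #|N z :&: N v| <= 3 * n + 100 * s.
Proof.
move=> zG vX; have h1 := nbhd_remainder vX.
have h2 : 100 * #|N z :&: U0| <= n by move: zG; rewrite inE.
have : N z :&: N v \subset (N z :&: U0) :|: (N v :&: W).
  apply/subsetP => y; rewrite /W !(in_setI, in_setU, in_setC) => /andP[-> ->].
  by rewrite /= orbN.
move/subset_leq_card; rewrite cardsU; lia.
Qed.

Let Y := [set y | [exists z in G, e z y]].
Let Z := ~: Y.

Lemma good_nbhd_sub z : z \in G -> N z \subset Y.
Proof.
by move=> zG; apply/subsetP => y; rewrite !inE => ezy; apply/existsP; exists z; rewrite zG.
Qed.

Lemma nbhd_hit_bad v : N v :&: Y \subset N v :\: G.
Proof.
apply/subsetP => y; rewrite in_setI in_setD => /andP[-> yY]; rewrite andbT.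
move: yY; rewrite inE => /existsP[z /andP[zG ezy]].
by apply/negP => yG; have := good_indep zG yG; rewrite ezy.
Qed.

Lemma good_card v : v \in X -> 75 * n <= 300 * #|G :&: N v|.
Proof.
move=> vX; have := nbhd_bad vX; have := cardsID G (N v); have := min_deg v.
rewrite setIC; lia.
Qed.

Let beta := \max_(z in G) #|Y :\: N z|.

(** Take a vertex [z] of [G] attaining the maximum [beta]: as [N z] lies in [Y], [#|Y|] is
    [#|N z| + beta]. *)
Lemma card_hit : n + 3 * beta <= 3 * #|Y| + s.
Proof.
have G0 : 0 < #|G|.
  have := good_card u0X; have := subset_leq_card (subsetIl G (N u0)); lia.
have [z zG bz] := eq_bigmax_cond (fun z => #|Y :\: N z|) G0.
rewrite /beta bz; have := cardsID (N z) Y.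
rewrite (setIidPr (good_nbhd_sub zG)); have := min_deg z; lia.
Qed.

Let P := [set y in Y | n <= 4 * #|G :\: N y|].

(** A neighbour of [v] misses all of [N v], which contains at least [n / 4] vertices of [G]. *)
Lemma nbhd_hit_sub v : v \in X -> N v :&: Y \subset P.
Proof.
move=> vX; apply/subsetP => y; rewrite in_setI => /andP[vy yY].
suff h : n <= 4 * #|G :\: N y| by rewrite [_ \in P]inE yY h.
have : G :&: N v \subset G :\: N y.
  apply/subsetP => z; rewrite !(in_setI, in_setD) => /andP[-> vz]; rewrite andbT.
  move: vy; rewrite inE => evy.
  have /setP/(_ z) := nbhd_adj evy; rewrite !inE in vz *.
  by rewrite vz /= => ->.
move/subset_leq_card; have := good_card vX; lia.
Qed.

(** Double counting of non-adjacent pairs between [G] and [Y]: at most [beta] per vertex of [G], at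
    least [n / 4] per vertex of [P]. *)
Lemma card_P : #|P| <= 4 * beta.
Proof.
have h1 : #|P| * n <= 4 * \sum_(y in Y) #|G :\: N y|.
  rewrite -sum_nat_const big_distrr /= big_mkcond [X in _ <= X]big_mkcond /=.
  by apply: leq_sum => y _; rewrite [_ \in P]inE; case: (y \in Y) => //=; case: ifP.
have h2 : \sum_(y in Y) #|G :\: N y| = \sum_(z in G) #|Y :\: N z|.
  transitivity (\sum_(y in Y) \sum_(z in G) (~~ e y z : nat)).
    apply: eq_bigr => y _; rewrite -sum1_card big_mkcond [RHS]big_mkcond /=.
    by apply: eq_bigr => z _; rewrite in_setD [_ \in N y]inE; case: (z \in G); case: (e y z).
  rewrite exchange_big; apply: eq_bigr => z _.
  rewrite -sum1_card big_mkcond [RHS]big_mkcond /=.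
  by apply: eq_bigr => y _; rewrite in_setD [_ \in N z]inE sym_e; case: (y \in Y); case: (e z y).
have h3 : \sum_(z in G) #|Y :\: N z| <= #|G| * beta.
  by rewrite -sum_nat_const; apply: leq_sum => z zG; apply: leq_bigmax_cond.
rewrite -(leq_pmul2r n_gt0); apply: leq_trans h1 _.
rewrite h2 -mulnA leq_mul2l /=; apply: leq_trans h3 _.
by rewrite mulnC leq_mul2l max_card orbT.
Qed.

(** * Vertices with many neighbours in [Y] *)

Let D := [set v in X | beta < 2 * #|N v :&: P|].

(** Pick [z] in [G] adjacent to [p]. The sets [N z], [N v], [N f] all avoid [N p], and [N z] barely
    meets the other two, so [N v :|: N f] fits into little more than a third of the vertices. *)
Lemma hit_cardI v f p : v \in X -> f \in X -> p \in Y -> e v p -> e f p ->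
  300 * (#|N v| + #|N f|) <= 300 * #|N v :&: N f| + 118 * n + 800 * s.
Proof.
move=> vX fX; rewrite inE => /existsP[z /andP[zG ezp]] evp efp.
have h1 := good_class_meet zG vX; have h2 := good_class_meet zG fX.
have h3 := min_deg z; have h4 := min_deg p.
have h5 : #|N z :&: (N v :|: N f)| <= #|N z :&: N v| + #|N z :&: N f|.
  by rewrite setIUr cardsU leq_subr.
have h6 : #|N p :|: (N z :|: (N v :|: N f))| = #|N p| + #|N z :|: (N v :|: N f)|.
  rewrite cardsU !setIUr; have E x : e x p -> N p :&: N x = set0.
    by rewrite sym_e; apply: nbhd_adj.
  by rewrite !E // !setU0 cards0 subn0.
have h7 : #|N p :|: (N z :|: (N v :|: N f))| <= n by apply: max_card.
have h8 := cardsUI (N z) (N v :|: N f).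
rewrite -cardsUI; clear -h1 h2 h3 h4 h5 h6 h7 h8; lia.
Qed.

(** Both [N v] and [N v'] cover most of [N f], so they intersect, which an edge forbids. *)
Lemma hit_common v v' f p p' : v \in X -> v' \in X -> f \in X ->
  p \in Y -> e v p -> e f p -> p' \in Y -> e v' p' -> e f p' -> ~~ e v v'.
Proof.
move=> vX v'X fX pY evp efp p'Y ev'p' efp'; apply/negP => evv'.
have h1 := hit_cardI vX fX pY evp efp.
have h2 := hit_cardI v'X fX p'Y ev'p' efp'.
have h5 := min_deg v; have h6 := min_deg v'; have h7 := min_deg f.
have : (N v :&: N f) :|: (N v' :&: N f) \subset N f by rewrite subUset !subsetIr.
move/subset_leq_card; rewrite cardsU -setIIl (nbhd_adj evv') set0I cards0 subn0.
clear -h1 h2 h5 h6 h7 s_small n_gt0; lia.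
Qed.

Lemma dense_colorable : colorable e D 8.
Proof.
pose disj (F : {set T}) := (F \subset D) &&
  [forall f in F, forall g in F, (f != g) ==> [disjoint N f :&: P & N g :&: P]].
have d0 : disj set0.
  by rewrite /disj sub0set; apply/forall_inP => f; rewrite inE.
have [F /maxsetP[/andP[FD /forall_inP Fdisj] Fmax] _] := maxset_exists d0.
have big f : f \in D -> #|P| < 8 * #|N f :&: P|.
  by rewrite inE => /andP[_]; have := card_P; lia.
have F8 : #|F| <= 8.
  have h1 : \sum_(f in F) #|N f :&: P| <= #|P|.
    have -> : \sum_(f in F) #|N f :&: P| = \sum_(y in P) #|[set f in F | e f y]|.
      transitivity (\sum_(f in F) \sum_(y in P) (e f y : nat)).
        apply: eq_bigr => f _; rewrite -sum1_card big_mkcond [RHS]big_mkcond /=.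
        by apply: eq_bigr => y _; rewrite in_setI [_ \in N f]inE; case: (y \in P); case: (e f y).
      rewrite exchange_big; apply: eq_bigr => y _.
      rewrite -sum1_card big_mkcond [RHS]big_mkcond /=.
      by apply: eq_bigr => f _; rewrite !inE; case: (f \in F); case: (e f y).
    rewrite -sum1_card; apply: leq_sum => y yP; rewrite leqNgt.
    apply/negP => /card_gt1P[f [g [+ + fg]]].
    rewrite !inE => /andP[fF efy] /andP[gF egy].
    have /forall_inP/(_ g gF)/implyP/(_ fg) := Fdisj f fF.
    by move/disjoint_setI0/setP/(_ y); rewrite !(in_setI, in_set0) yP !inE efy egy.
  have h2 : #|F| * #|P|.+1 <= 8 * \sum_(f in F) #|N f :&: P|.
    rewrite -sum_nat_const big_distrr /=; apply: leq_sum => f fF.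
    by apply: big; apply: (subsetP FD).
  nia.
(* By maximality of [F], the trace of [v] on [P] meets that of some [f] in [F]; for [v] in [F] this
   is [v] itself, its trace being nonempty. That [f] is the colour of [v]. *)
have pick v : exists f, v \in D -> f \in F /\ exists2 p, p \in P & e v p && e f p.
  have [vD|] := boolP (v \in D); last by exists v.
  have [p0] : exists p, p \in N v :&: P.
    by apply/card_gt0P; have := big v vD; lia.
  rewrite in_setI inE => /andP[evp0 p0P].
  have [vF|vF] := boolP (v \in F).
    by exists v => _; split=> //; exists p0; rewrite // evp0.
  have : ~~ disj (v |: F).
    apply: contra vF => dv; rewrite -(Fmax _ dv) ?setU11 // subsetUr //.
  have vFD : v |: F \subset D by rewrite subUset sub1set vD.
  rewrite /disj vFD /= => /forall_inPn[f fF] /forall_inPn[g gF].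
  rewrite negb_imply => /andP[fg]; rewrite -setI_eq0 => /set0Pn[p].
  rewrite !in_setI => /andP[/andP[pf pP] /andP[pg _]].
  move: pf pg; rewrite !inE => efp egp.
  move: fF gF fg efp egp; rewrite !in_setU1.
  case/predU1P=> [->|fF]; case/predU1P=> [->|gF] fg efp egp.
  - by rewrite eqxx in fg.
  - by exists g => _; split=> //; exists p => //; rewrite efp egp.
  - by exists f => _; split=> //; exists p => //; rewrite efp egp.
  - have /forall_inP/(_ g gF)/implyP/(_ fg) := Fdisj f fF.
    by move/disjoint_setI0/setP/(_ p); rewrite !(in_setI, in_set0) pP !inE efp egp.
have [c cP] := fin_all_exists pick.
exists (fun v => index (c v) (enum F)); split=> [v vD|v v' vD v'D evv' E].
  have [cF _] := cP v vD; apply: leq_trans F8.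
  by rewrite cardE index_mem mem_enum.
have [cF [p pP /andP[evp efp]]] := cP v vD.
have [cF' [p' pP' /andP[evp' efp']]] := cP v' v'D.
have cc : c v = c v'.
  by rewrite -(nth_index v (s := enum F) (x := c v)) ?mem_enum // E nth_index ?mem_enum.
rewrite -cc in efp'.
have DX : {subset D <= X} by move=> x; rewrite inE => /andP[].
have PY : {subset P <= Y} by move=> x; rewrite [_ \in P]inE => /andP[].
have cX : c v \in X by apply: DX; apply: (subsetP FD).
by have := hit_common (DX v vD) (DX v' v'D) cX (PY p pP) evp efp (PY p' pP') evp' efp';
  rewrite evv'.
Qed.

(** * Remaining vertices: neighbourhoods alternating along edges *)

Let A v := N v :&: Z.

Lemma A_card v : v \in X -> n <= 5 * #|A v|.
Proof.
move=> vX; have := subset_leq_card (nbhd_hit_bad v); have := nbhd_bad vX.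
by have := cardsID Y (N v); rewrite setDE -/Z -/(A v); have := min_deg v; lia.
Qed.

Lemma A_adj u v : e u v -> A u :&: A v = set0.
Proof. by move=> euv; rewrite /A -setIIl (nbhd_adj euv) set0I. Qed.

(* The [beta] neighbours that two sparse vertices may lose in [Y] are paid for by
   the [beta] vertices of [Y] missed by a vertex of [G], so no error beyond [s]
   appears. *)
Lemma sparse_card u v : u \in X :\: D -> v \in X :\: D ->
  #|Z| <= #|A u| + #|A v| + s.
Proof.
have key w : w \in X :\: D -> 2 * n <= 6 * #|A w| + 3 * beta + 2 * s.
  rewrite in_setD => /andP[wD wX].
  have wP : 2 * #|N w :&: P| <= beta by move: wD; rewrite inE wX -leqNgt.
  have : N w :&: Y \subset N w :&: P by rewrite subsetI subsetIl nbhd_hit_sub.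
  move/subset_leq_card; have := cardsID Y (N w); rewrite setDE -/Z -/(A w).
  by have := min_deg w; lia.
move=> /key h1 /key h2; have := card_hit; have := cardsC Y; rewrite -/Z; lia.
Qed.

(** Induction along an edge from [y] to [x]: disjointness puts [A v :&: A x] inside [A v :\: A y] at
    no cost, while passing from a small [A v :&: A y] to [A v :\: A x] costs the [s] vertices of [Z]
    that [A x] and [A y] may leave uncovered. *)
Lemma sparse_ball v x r : v \in X :\: D -> x \in ball e (X :\: D) v r ->
  (#|A v :\: A x| <= s * r) || (#|A v :&: A x| <= s * r).
Proof.
move=> vS; elim: r x => [|r IH] x /=.
  by rewrite inE => /eqP ->; rewrite setDv cards0.
rewrite in_setU => /orP[/IH|].
  by case/orP => h; apply/orP; [left|right]; apply: leq_trans h _; rewrite leq_mul2l leqnSn orbT.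
rewrite inE => /andP[xS /existsP[y /andP[yb eyx]]].
have yS : y \in X :\: D by apply: (subsetP (ball_sub e r vS)).
case/orP: (IH y yb) => h; apply/orP; [right|left].
  apply: leq_trans (_ : s * r <= _); last by rewrite leq_mul2l leqnSn orbT.
  apply: leq_trans h; apply: subset_leq_card; apply/subsetP => w.
  rewrite in_setI in_setD => /andP[-> wx]; rewrite andbT; apply/negP => wy.
  by have /setP/(_ w) := A_adj eyx; rewrite in_setI wy wx inE.
have h1 := sparse_card xS yS.
have h2 : #|A v :|: A x :|: A y| <= #|Z|.
  by apply: subset_leq_card; rewrite !subUset !subsetIr.
have h3 := cardsUI (A v :|: A x) (A y).
have h4 : (A v :|: A x) :&: A y = A v :&: A y.
  by rewrite setIUl [A x :&: _]setIC (A_adj eyx) setU0.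
rewrite h4 in h3.
have h5 := cardsUI (A v) (A x); have h6 := cardsID (A x) (A v).
rewrite mulnS; clear -h h1 h2 h3 h5 h6; lia.
Qed.

Lemma class_colorable (q R K : nat) : 0 < q ->
  n * q ^ R < q.+1 ^ R -> n < q ^ K -> 5 * (2 * R + 1) * s < n ->
  colorable e X (8 + K * 2).
Proof.
move=> q0 ltR ltK sR.
apply: (colorableS (Y := D :|: (X :\: D))) (leqnn _) _.
  by apply/subsetP => x xX; rewrite in_setU in_setD xX andbT orbN.
apply: colorable_setU dense_colorable _.
apply: (@ball_growing T e sym_e _ q R K (fun v x => #|A v :\: A x| <= s * R)) => //.
- by apply: leq_ltn_trans ltR; rewrite leq_mul2r max_card orbT.
- by apply: leq_ltn_trans ltK; apply: max_card.
move=> v x y vS xb yb exy; apply/negP => /eqP E.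
have vX : v \in X by move: vS; rewrite in_setD => /andP[].
have xS := subsetP (ball_sub e R vS) x xb.
have yS := subsetP (ball_sub e R vS) y yb.
have yX : y \in X by move: yS; rewrite in_setD => /andP[].
have h1 := sparse_ball vS xb; have h2 := sparse_ball vS yb.
have h0 : A x :&: A y = set0 := A_adj exy.
(* First case: [A v] is nearly contained in both [A x] and [A y], which are disjoint, so it is too
   small. *)
case: leqP h1 E h2 => [hx _ /esym hy _|_ /= hx /esym/negbT hy].
  have : A v \subset (A v :\: A x) :|: (A v :\: A y).
    by apply/subsetP => z zv; rewrite -setDIr h0 setD0.
  move/subset_leq_card; rewrite cardsU; have := A_card vX.
  clear -hx hy sR; lia.
(* Second case: [A v], [A x], [A y] are nearly disjoint in [Z], but [A v] and [A x] alone fill [Z]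
   up to [s], so [A y] is too small. *)
rewrite (negPf hy) /= => {}hy.
have h3 : #|A v :|: (A x :|: A y)| <= #|Z|.
  by apply: subset_leq_card; rewrite !subUset !subsetIr.
have h4 := cardsUI (A v) (A x :|: A y); have h5 := cardsUI (A x) (A y).
have h6 : #|A v :&: (A x :|: A y)| <= #|A v :&: A x| + #|A v :&: A y|.
  by rewrite setIUr cardsU leq_subr.
rewrite h0 cards0 in h5.
have h7 := sparse_card vS xS; have h8 := A_card yX.
clear -hx hy sR h3 h4 h5 h6 h7 h8; lia.
Qed.

End Class.

Lemma near_class_colorable (X : {set T}) (q R K : nat) :
  (forall u v, u \in X -> v \in X -> 200 * 100 * edges e (N u) (N v) <= n * n) ->
  0 < q -> n * q ^ R < q.+1 ^ R -> n < q ^ K -> 5 * (2 * R + 1) * s < n ->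
  colorable e X (8 + K * 2).
Proof.
move=> near q0 ltR ltK sR.
have [/existsP[u /existsP[v /and3P[uX vX euv]]]|/existsPn H] :=
  boolP [exists u, exists v, [&& u \in X, v \in X & e u v]].
  exact (class_colorable uX vX euv near q0 ltR ltK sR).
exists (fun _ => 0); split=> // x y xX yX exy _.
by have /existsPn/(_ y) := H x; rewrite xX yX exy.
Qed.

End Structure.

(** * Choice of parameters *)

Lemma linear_lt_exp2 (c : nat) : exists j0, forall j, j0 <= j -> c * j < 2 ^ j.
Proof.
exists (4 * c.+1) => j hj.
have h1 : j - j./2 < 2 ^ (j - j./2) by apply: ltn_expl.
have h2 : j./2 < 2 ^ j./2 by apply: ltn_expl.
have -> : 2 ^ j = 2 ^ (j - j./2) * 2 ^ j./2 by rewrite -expnD; congr (_ ^ _); lia.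
have h3 : c.+1 * 2 <= 2 ^ j./2 by lia.
have h4 : j <= 2 * (j - j./2) by lia.
nia.
Qed.

(** Bernoulli's inequality for [(1 + 1/q)^m], with denominators cleared. *)
Lemma expn_bernoulli q m : (q + m) * q ^ m <= q * q.+1 ^ m.
Proof. by elim: m => [|m IH]; rewrite ?expn0 ?addn0 // !expnS; nia. Qed.

Lemma exp2_le_growth q l : 0 < q -> 2 ^ l * q ^ (q * l) <= q.+1 ^ (q * l).
Proof.
move=> q0; rewrite !expnM -expnMn.
have h : 2 * q ^ q <= q.+1 ^ q.
  by rewrite -(leq_pmul2l q0) mulnA muln2 -addnn expn_bernoulli.
by case: l => // l; rewrite leq_exp2r.
Qed.

Lemma root_bounds d m : 0 < d -> exists q, q ^ d <= m < q.+1 ^ d.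
Proof.
move=> d0; elim: m => [|m [q /andP[h1 h2]]].
  by exists 0; rewrite exp0n // exp1n.
have [h|h] := ltnP m.+1 (q.+1 ^ d); first by exists q; rewrite h andbT ltnW.
by exists q.+1; rewrite h (leq_ltn_trans h2) // ltn_exp2r.
Qed.

(* With [l ~ 2 k log q], balls of radius [q l] exhibit slow growth, while their
   radius is still below [n / s >= q^2 / 4]. *)
Lemma min_degree_colorable (k : nat) : 0 < k ->
  exists q0 C : nat, forall (T : finType) (e : rel T) (s q : nat),
    simple_graph e -> triangle_free e -> q0 <= q ->
    q ^ (2 * k) <= #|T| < q.+1 ^ (2 * k) ->
    q ^ 2 * s <= 4 * #|T| -> (forall x, #|T| <= 3 * #|nbhd e x| + s) ->
    chromatic_le e C.
Proof.
move=> k0; have [j0 Hj] := linear_lt_exp2 (200 * k).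
have [M HM] := edges_coloring (isT : 0 < 200 * 100).
(* The term [2 ^ j0] makes the logarithm of [q] large enough for [Hj]; [20] gives
   [400 s <= q^2 s <= 4n]. Each of the [M] classes takes [8 + 2K] colours with [K = 4k], since
   [n < (q+1)^(2k) <= q^(4k)]. *)
exists (2 ^ j0 + 20), (M * (8 + 4 * k * 2)) => T e s q [sym_e _] tri hq
  /andP[hn1 hn2] hs hdeg.
have q20 : 20 <= q by lia.
have q0 : 0 < q by lia.
have n0 : 0 < #|T| by apply: leq_trans hn1; rewrite expn_gt0 q0.
(* Binary length of [q]: [2^(j-1) <= q < 2^j], whence [n < 2^l] for the [l] below. *)
pose j := (trunc_log 2 q).+1.
have /andP[jl jr] := trunc_log_bounds (isT : 1 < 2) q0.
rewrite -/j in jr.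
have hj : 100 * k * j < q.
  have : 200 * k * j < 2 ^ j.
    by apply: Hj; apply: leqW; apply: trunc_log_max => //; lia.
  rewrite /j expnS in jl *; lia.
pose l := j * (2 * k); pose R := q * l.
have nl : #|T| < 2 ^ l.
  by apply: leq_trans hn2 _; rewrite /l [X in _ <= X]expnM leq_exp2r // muln_gt0.
have ltR : #|T| * q ^ R < q.+1 ^ R.
  apply: leq_trans (exp2_le_growth l q0); rewrite -/R.
  by rewrite ltn_pmul2r // expn_gt0 q0.
have ltK : #|T| < q ^ (4 * k).
  apply: leq_trans hn2 _; rewrite (_ : 4 * k = 2 * (2 * k)); last lia.
  by rewrite [X in _ <= X]expnM leq_exp2r ?muln_gt0 // -mulnn; nia.
have jk : 0 < k * j by rewrite muln_gt0 k0.
have hR : 20 * (2 * R + 1) < q ^ 2.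
  rewrite /R /l -mulnn; set kj := k * j in jk.
  have -> : q * (j * (2 * k)) = 2 * (q * kj) by rewrite /kj; clear; lia.
  have : q * (100 * kj) < q * q by rewrite ltn_pmul2l // /kj mulnA .
  have : 0 < q * kj by rewrite muln_gt0 q0.
  lia.
have sR : 5 * (2 * R + 1) * s < #|T|.
  have q2 : 0 < q ^ 2 by rewrite expn_gt0 q0.
  rewrite -(ltn_pmul2l q2).
  apply: (@leq_ltn_trans (5 * (2 * R + 1) * (4 * #|T|))).
    by rewrite mulnCA leq_mul2l hs orbT.
  rewrite mulnA ltn_pmul2r //; lia.
have s100 : 100 * s <= #|T|.
  have : 20 * 20 * s <= q ^ 2 * s by rewrite leq_mul2r -mulnn leq_mul ?orbT.
  lia.
have [f Hf] := HM T e n0.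
apply: colorable_chromatic.
apply: (colorable_classes (f := fun x => f (nbhd e x))) => i.
apply: (near_class_colorable sym_e tri n0 s100 hdeg _ q0 ltR ltK sR) => u v.
rewrite !inE /= => /eqP fu /eqP fv.
have := Hf (nbhd e u) (nbhd e v); rewrite fu fv => /(_ erefl).
by rewrite (edges_self sym_e tri) muln0 add0n mulnn.
Qed.

(** * From real powers to integer bounds *)

Lemma INR_expn q m : INR (q ^ m) = (INR q ^ m)%R.
Proof. by elim: m => //= m IH; rewrite expnS [INR _]mult_INR IH. Qed.

(** Since [eta * k >= 1], [q^2 <= q^(2k eta) <= m^eta]. *)
Lemma Rpower_gain (q k m : nat) (eta : R) : 0 < q -> q ^ (2 * k) <= m ->
  (1 <= eta * INR k)%R ->
  (INR (q ^ 2) * Rpower (INR m) (1 - eta) <= INR m)%R.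
Proof.
move=> q0 hm hk.
have q1 : (1 <= INR q)%R by apply: (le_INR 1); apply/ssrnat.leP.
have qm : (INR q ^ (2 * k) <= INR m)%R.
  by rewrite -INR_expn; apply: le_INR; apply/ssrnat.leP.
have k0 := pos_INR k.
have eta0 : (0 <= eta)%R.
  have [//|neg] := Rle_or_lt 0 eta.
  by have := Rmult_le_compat_r _ _ _ k0 (Rlt_le _ _ neg); rewrite Rmult_0_l; Lra.lra.
have m0 : (0 < INR m)%R by apply: Rlt_le_trans qm; apply: pow_lt; Lra.lra.
have -> : (1 - eta = 1 + - eta)%R by [].
rewrite Rpower_plus Rpower_1 // Rpower_Ropp.
have p0 : (0 < Rpower (INR m) eta)%R by apply: exp_pos.
suff h : (INR (q ^ 2) <= Rpower (INR m) eta)%R.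
  apply: (Rmult_le_reg_r _ _ _ p0).
  have -> : (INR (q ^ 2) * (INR m * / Rpower (INR m) eta) * Rpower (INR m) eta =
    INR (q ^ 2) * INR m)%R by field_simplify_eq; Lra.lra.
  by rewrite Rmult_comm; apply: Rmult_le_compat_l => //; Lra.lra.
rewrite INR_expn.
apply: (Rle_trans _ (Rpower (INR q ^ (2 * k)) eta)); last first.
  by apply: Rle_Rpower_l => //; split=> //; apply: pow_lt; Lra.lra.
rewrite -!Rpower_pow; try Lra.lra.
rewrite Rpower_mult; apply: Rle_Rpower => //.
by rewrite [INR (2 * k)]mult_INR /=; Lra.lra.
Qed.

Theorem theorem6p4 :
  forall eta : R, (0 < eta)%R ->
  exists C : nat,
    forall (T : finType) (e : rel T),
      simple_graph e -> triangle_free e ->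
      (forall x : T,
          (INR #|T| / 3 - Rpower (INR #|T|) (1 - eta) <= INR (deg e x))%R) ->
      chromatic_le e C.
Proof.
move=> eta eta0.
have [k hk] : exists k : nat, (1 <= eta * INR k)%R.
  have [k hk] := INR_unbounded (/ eta); exists k.
  apply: (Rmult_le_reg_l (/ eta)); first exact: Rinv_0_lt_compat.
  by rewrite -Rmult_assoc Rinv_l; Lra.lra.
have k0 : 0 < k by case: k hk => //=; Lra.lra.
have kk : 0 < 2 * k by rewrite muln_gt0.
have [q0 [C HC]] := min_degree_colorable k0.
(* The second summand serves small graphs, whose vertices all get distinct colours. *)
exists (C + q0.+1 ^ (2 * k)) => T e sg tri hdeg.
have weaken a b : a <= b -> chromatic_le e a -> chromatic_le e b.
  move=> ab [c cP]; exists (fun x => widen_ord ab (c x)) => x y exy.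
  by move/(congr1 val) => /= /val_inj; apply: cP.
have [small|large] := leqP #|T| (q0.+1 ^ (2 * k)).
  apply: (weaken #|T|); first by apply: leq_trans small (leq_addl _ _).
  exists enum_rank => x y exy /enum_rank_inj xy; subst y.
  by have [_ irr] := sg; rewrite irr in exy.
apply: (weaken C); first exact: leq_addr.
have [q /andP[hq1 hq2]] := root_bounds #|T| kk.
have q0q : q0 < q.
  by have := ltn_trans large hq2; rewrite ltn_exp2r.
have qpos : 0 < q by apply: leq_ltn_trans q0q.
have q2pos : 0 < q ^ 2 by rewrite expn_gt0 qpos.
have q2n : q ^ 2 <= #|T|.
  by apply: leq_trans hq1; rewrite leq_pexp2l // leq_pmulr.
(* The deficit [3 n^(1-eta)] is at most [3n / q^2], rounded up here; rounding stays below [4n / q^2]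
   because [q^2 <= n]. *)
pose s := (3 * #|T| %/ q ^ 2).+1.
have s_lo : 3 * #|T| < q ^ 2 * s by rewrite [q ^ 2 * s]mulnC ltn_ceil.
have s_hi : q ^ 2 * s <= 4 * #|T|.
  have := leq_divM (3 * #|T|) (q ^ 2); rewrite /s mulnS [q ^ 2 * _]mulnC; clear -q2n; lia.
apply: (HC T e s q sg tri (ltnW q0q)) => //; first by rewrite hq1 hq2.
move=> x; rewrite -(leq_pmul2l q2pos).
suff : q ^ 2 * #|T| <= 3 * (q ^ 2 * #|nbhd e x|) + 3 * #|T|.
  move: s_lo; rewrite mulnDr; set a := q ^ 2 * s; set b := q ^ 2 * #|T|.
  have -> : q ^ 2 * (3 * #|nbhd e x|) = 3 * (q ^ 2 * #|nbhd e x|) by lia.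
  lia.
apply/ssrnat.leP; apply: INR_le.
rewrite [INR (_ + _)]plus_INR [INR (3 * #|T|)]mult_INR [INR (q ^ 2 * #|T|)]mult_INR.
rewrite [INR (3 * _)]mult_INR [INR (q ^ 2 * _)]mult_INR.
have := hdeg x; have := Rpower_gain qpos hq1 hk.
rewrite -[deg e x]/#|nbhd e x|.
have p2 : (0 < INR (q ^ 2))%R by apply: (lt_INR 0); apply/ssrnat.ltP.
set r := Rpower _ _; set a := INR (q ^ 2) in p2 *; set n := INR #|T|.
set d := INR _ => h1 h2.
have h3 : (a * (n / 3 - r) <= a * d)%R by apply: Rmult_le_compat_l => //; Lra.lra.
have -> : INR 3 = 3%R by rewrite /=; Lra.lra.
Lra.lra.
Qed.
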